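(* Let $\Gamma$ be a discrete abelian group and let $E\subseteq\Gamma$ be a countably infinite independent subset, enumerated as a sequence $(e_n)_{n\ge 1}$. If every element of $E$ has infinite order, then $\mathbb{U}(E,\mathbb{T}^{\mathbb{T}})$ is dense in $\widehat{\Gamma}^{\mathbb{T}}$ and has the Baire property.
   Context: Groups are written multiplicatively. $\mathbb{T}$ is the compact group of complex numbers of modulus one, and $\mathbb{T}^{\mathbb{T}}$ is the compact abelian group of all functions $\mathbb{T}\to\mathbb{T}$ with pointwise multiplication and the product topology. For a topological abelian group $\mathcal{G}$, the dual group $\widehat{\mathcal{G}}$ is the group of continuous homomorphisms $\mathcal{G}\to\mathbb{T}$ (characters). Since $\Gamma$ is discrete, $\widehat{\Gamma}=\mathrm{Hom}(\Gamma,\mathbb{T})$, a compact group with the topology of pointwise convergence. $\widehat{\Gamma}^{\mathbb{T}}$ is the set of all functions $\mathbb{T}\to\widehat{\Gamma}$ with the product topology. It is identified with $\mathrm{Hom}(\Gamma,\mathbb{T}^{\mathbb{T}})$ via the topological group isomorphism $h\mapsto\widetilde h$, $\widetilde h(e)(t)=h(t)(e)$ for $e\in\Gamma$, $t\in\mathbb{T}$. Independent set: a subset $X\subseteq\Gamma\setminus\{1\}$ is independent if for every finite $F\subseteq X$ and all integers $m_\gamma$ ($\gamma\in F$), $\prod_{\gamma\in F}\gamma^{m_\gamma}=1$ if and only if $\gamma^{m_\gamma}=1$ for all $\gamma\in F$. Weak uniform distribution: a sequence $(x_n)_{n\ge1}$ in a compact abelian group $K$ is weakly uniformly distributed if for each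 nontrivial character $\chi\in\widehat{K}$ and each positive integer $k$ there exists a positive integer $N$ such that $\left|\frac1N\sum_{n=1}^N\chi(x_n)\right|<\frac1k$. For the fixed enumeration $(e_n)$ of $E$, $\mathbb{U}(E,K)$ is the set of all $h\in\mathrm{Hom}(\Gamma,K)$ such that the sequence $(h(e_n))_{n\ge1}$ is weakly uniformly distributed in $K$. Here $K=\mathbb{T}^{\mathbb{T}}$, and $\mathbb{U}(E,\mathbb{T}^{\mathbb{T}})$ is regarded as a subset of $\widehat{\Gamma}^{\mathbb{T}}$ via the identification of $\widehat{\Gamma}^{\mathbb{T}}$ with $\mathrm{Hom}(\Gamma,\mathbb{T}^{\mathbb{T}})$ given by $h\mapsto\widetilde h$, $\widetilde h(e)(t)=h(t)(e)$. Baire property: a dense subspace $X$ of $\widehat{\Gamma}^{\mathbb{T}}$ has the Baire property if $X$ intersects every set of the form $W\cap\bigcap_{n=1}^\infty Q_n$, where $W$ is a nonempty open subset of $\widehat{\Gamma}^{\mathbb{T}}$ and each $Q_n$ is a dense open subset of $\widehat{\Gamma}^{\mathbb{T}}$. *)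

(* Defs.v *)
From HB Require Import structures.
From mathcomp Require Import all_boot all_order all_algebra.
From mathcomp Require Import finmap complex.
From mathcomp Require Import all_classical all_reals all_analysis.

Set Implicit Arguments.
Unset Strict Implicit.
Unset Printing Implicit Defensive.

Import Order.TTheory GRing.Theory Num.Theory.
Import numFieldNormedType.Exports.

Local Open Scope classical_set_scope.
Local Open Scope ring_scope.
Local Open Scope complex_scope.

(* Abelian groups are `zmodType`s, topological abelian groups are              *)
(* `topologicalZmodType`s: every group law is written `+`, including that of   *)
(* the circle group, which is the multiplication of complex numbers (circleD). *)

Section Circle.
Variable R : realType.

Record circle := Circle {
  circle_val :> R[i];
  circle_norm : `|circle_val| == 1 }.

HB.instance Definition _ := [isSub for circle_val].
HB.instance Definition _ := [Choice of circle by <:].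

Definition circle_one := @Circle 1 (introT eqP (normr1 R[i])).

Fact circle_mul_subproof (x y : circle) : `|circle_val x * circle_val y| == 1.
Proof.
by rewrite normrM (eqP (circle_norm x)) (eqP (circle_norm y)) mulr1.
Qed.
Definition circle_mul (x y : circle) := Circle (circle_mul_subproof x y).

Fact circle_inv_subproof (x : circle) : `|(circle_val x)^-1| == 1.
Proof. by rewrite normfV (eqP (circle_norm x)) invr1. Qed.
Definition circle_inv (x : circle) := Circle (circle_inv_subproof x).

Fact circle_mulA : associative circle_mul.
Proof. by move=> x y z; apply/val_inj; exact: mulrA. Qed.

Fact circle_mulC : commutative circle_mul.
Proof. by move=> x y; apply/val_inj; exact: mulrC. Qed.

Fact circle_mul1 : left_id circle_one circle_mul.
Proof. by move=> x; apply/val_inj; exact: mul1r. Qed.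

Lemma circle_neq0 (x : circle) : circle_val x != 0.
Proof. by rewrite -normr_eq0 (eqP (circle_norm x)) oner_eq0. Qed.

Fact circle_mulV : left_inverse circle_one circle_inv circle_mul.
Proof. by move=> x; apply/val_inj; exact/mulVf/circle_neq0. Qed.

HB.instance Definition _ := GRing.isZmodule.Build circle
  circle_mulA circle_mulC circle_mul1 circle_mulV.

Lemma circle0 : circle_val 0 = 1. Proof. by []. Qed.
Lemma circleD (x y : circle) : circle_val (x + y) = circle_val x * circle_val y.
Proof. by []. Qed.
Lemma circleN (x : circle) : circle_val (- x) = (circle_val x)^-1.
Proof. by []. Qed.

HB.instance Definition _ :=
  Topological.copy circle (initial_topology (circle_val : circle -> R[i]^o)).

Lemma circle_val_continuous : continuous (circle_val : circle -> R[i]^o).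
Proof. exact: initial_continuous. Qed.

Lemma continuous_circle (S : topologicalType) (f : S -> circle) :
  continuous (circle_val \o f : S -> R[i]^o) -> continuous f.
Proof.
move=> /continuousP cf; apply/continuousP => _ [A oA <-].
by rewrite -comp_preimage; exact: cf.
Qed.

Fact circle_add_continuous : continuous (fun x : circle * circle => x.1 + x.2).
Proof.
apply: continuous_circle => x.
apply: (@cvgM R[i] _ _ _ (fun z : circle * circle => circle_val z.1)
  (fun z : circle * circle => circle_val z.2)).
- exact/(cvg_comp _ _ (@cvg_fst _ _ _ _ _))/circle_val_continuous.
- exact/(cvg_comp _ _ (@cvg_snd _ _ _ _ _))/circle_val_continuous.
Qed.

Fact circle_opp_continuous : continuous (-%R : circle -> circle).
Proof.
apply: continuous_circle => x.
apply: (@continuous_comp _ R[i]^o R[i]^o (@circle_val) GRing.inv).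
  exact: circle_val_continuous.
exact/inv_continuous/circle_neq0.
Qed.

HB.instance Definition _ :=
  PreTopologicalNmodule_isTopologicalNmodule.Build circle circle_add_continuous.
HB.instance Definition _ :=
  TopologicalNmodule_isTopologicalZmodule.Build circle circle_opp_continuous.

End Circle.

Section Pointwise.
Variables (I : Type) (G : topologicalZmodType).

HB.instance Definition _ := GRing.Zmodule.copy {ptws I -> G} (I -> G).

Lemma ptws_eval_continuous (i : I) : continuous (fun f : {ptws I -> G} => f i).
Proof.
move=> f; have /cvg_sup/(_ i) : f --> f by exact: cvg_id.
move=> cf A /(@initial_continuous {ptws I -> G} G (fun f => f i) f) nA.
exact: cf.
Qed.

Lemma continuous_ptws (S : topologicalType) (f : S -> {ptws I -> G}) :
  (forall i, continuous (fun s => f s i)) -> continuous f.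
Proof.
move=> cf s; apply/cvg_sup => i A /= [_ [[B oB <-] Bfs BA]].
have nB : nbhs s [set t | B (f t i)].
  by apply: (cf i s); exact: open_nbhs_nbhs.
by apply: (@filterS _ (nbhs s) _ _ (f @^-1` A) _ nB) => t Bt; exact: BA.
Qed.

Fact ptws_add_continuous :
  continuous (fun f : {ptws I -> G} * {ptws I -> G} => f.1 + f.2).
Proof.
apply: continuous_ptws => i f.
apply: (@continuous_comp _ (G * G)%type G
  (fun f : {ptws I -> G} * {ptws I -> G} => (f.1 i, f.2 i))
  (fun x => x.1 + x.2)); last exact: add_continuous.
apply: cvg_pair.
- apply: (@continuous_comp _ _ _ fst (fun g : {ptws I -> G} => g i)).
    exact: cvg_fst.
  exact: ptws_eval_continuous.
- apply: (@continuous_comp _ _ _ snd (fun g : {ptws I -> G} => g i)).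
    exact: cvg_snd.
  exact: ptws_eval_continuous.
Qed.

Fact ptws_opp_continuous : continuous (-%R : {ptws I -> G} -> {ptws I -> G}).
Proof.
apply: continuous_ptws => i f.
apply: (@continuous_comp _ _ _ (fun f : {ptws I -> G} => f i) -%R).
  exact: ptws_eval_continuous.
exact: opp_continuous.
Qed.

HB.instance Definition _ :=
  PreTopologicalNmodule_isTopologicalNmodule.Build {ptws I -> G}
    ptws_add_continuous.
HB.instance Definition _ :=
  TopologicalNmodule_isTopologicalZmodule.Build {ptws I -> G}
    ptws_opp_continuous.

End Pointwise.

Definition Hom (G H : zmodType) : set (G -> H) := [set f | zmod_morphism f].

Definition characters (R : realType) (K : topologicalZmodType) :
    set (K -> circle R) :=
  [set chi | continuous chi /\ zmod_morphism chi].

(* For a discrete group the dual carries the topology of pointwise convergence, *)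
(* here the subtype topology inherited from the product topology.              *)
Definition discrete_dual (R : realType) (Gamma : zmodType) : Type :=
  set_type (@Hom Gamma (circle R) : set {ptws Gamma -> circle R}).

HB.instance Definition _ (R : realType) (Gamma : zmodType) :=
  Topological.on (discrete_dual R Gamma).

Definition independent (Gamma : zmodType) (X : set Gamma) : Prop :=
  ~ X 0 /\
  forall (F : {fset Gamma}) (m : Gamma -> int), [set` F] `<=` X ->
    \sum_(g <- F) g *~ m g = 0 <-> {in F, forall g, g *~ m g = 0}.

Definition infinite_order (Gamma : zmodType) (g : Gamma) : Prop :=
  forall n : nat, (0 < n)%N -> g *+ n <> 0.

(* Sequences indexed from 1 are represented by `x : nat -> K`, x 0 being the   *)
(* first term.                                                                 *)
Definition weakly_uniformly_distributed (R : realType) (K : topologicalZmodType)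
    (x : nat -> K) : Prop :=
  forall chi : K -> circle R, characters chi -> chi <> (fun=> 0) ->
  forall k : nat, (0 < k)%N -> exists2 N : nat, (0 < N)%N &
    `|N%:R^-1 * \sum_(n < N) (chi (x n) : R[i])| < k%:R^-1.

Definition ud_homs (R : realType) (Gamma : zmodType) (K : topologicalZmodType)
    (e : nat -> Gamma) : set (Gamma -> K) :=
  [set h | Hom h /\ weakly_uniformly_distributed R (h \o e)].

Section Tilde.
Variables (R : realType) (Gamma : zmodType).

Definition tilde (h : {ptws circle R -> discrete_dual R Gamma}) :
    Gamma -> {ptws circle R -> circle R} :=
  fun g t => set_val (h t) g.

Lemma tilde_Hom h : Hom (tilde h).
Proof.
move=> x y; apply/funext => t; rewrite /tilde.
exact: (set_mem (svalP (h t))).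
Qed.

Lemma tilde_inj : injective tilde.
Proof.
move=> h1 h2 eq_h; apply/funext => t; apply/val_inj/funext => g.
by have := congr1 (fun f => f g t) eq_h.
Qed.

Lemma tilde_surj (f : Gamma -> {ptws circle R -> circle R}) :
  Hom f -> exists h, tilde h = f.
Proof.
move=> fH; have fHt t : Hom (fun g => f g t) by move=> x y; rewrite fH.
by exists (fun t => exist (fun g => g \in _) _ (mem_set (fHt t))).
Qed.

End Tilde.

Definition baire_property (S : topologicalType) (X : set S) : Prop :=
  forall (W : set S) (Q : nat -> set S), open W -> W !=set0 ->
    (forall n, open (Q n) /\ dense (Q n)) ->
    X `&` (W `&` \bigcap_n Q n) !=set0.

(* Main.v *)
(** Finitely many group elements generate a subgroup which meets the span of a
    tail of [e] trivially, and the circle is divisible; so the values at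
    [e n], n large, of a point of the dual power may be changed at will, on
    every coordinate, without disturbing any finite set of other values.

    There is one sequence [y] in the power of the circle and blocks of indices,
    each much longer than everything before it, such that for every nontrivial
    character [chi] the sum of [chi (y n)] over all late blocks vanishes: on
    each block [y] runs repeatedly through a finite subgroup, and these finite subgroups
    are eventually dense.  A homomorphism which, coordinate by coordinate, gets
    close to [y] on infinitely many blocks is therefore weakly uniformly
    distributed; no description of the characters is needed.

    Given dense open sets [Q n], one shrinks basic open sets, at step [j] into
    [Q j] and towards [y] on a new block for the coordinates constrained so
    far.  Compactness gives a point in the intersection.  It is constrained on
    countably many coordinates only, and on the others it is replaced by a
    homomorphism equal to [y]. *)
Require Import Defs.
From mathcomp Require Import all_boot all_order all_algebra.
From mathcomp Require Import finmap complex.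
From mathcomp Require Import all_classical all_reals all_analysis.

Import Order.TTheory GRing.Theory Num.Theory.
Import numFieldNormedType.Exports.

Local Open Scope classical_set_scope.
Local Open Scope ring_scope.

(** * Extension of homomorphisms into divisible groups *)

Section HomExtension.
Variables G D : zmodType.
Hypothesis divD : forall (n : nat) (d : D), (0 < n)%N -> exists d', d' *+ n = d.

(* The graph of a homomorphism defined on a subgroup of [G], except that [t] may
   be empty: [t 0] is assumed where it is needed. *)
Definition graph_hom (t : set (G * D)) :=
  (forall p q, t p -> t q -> t (p - q)) /\ (forall d, t (0, d) -> d = 0).

Lemma graph_homZ t p (k : int) : graph_hom t -> t p -> t (p.1 *~ k, p.2 *~ k).
Proof.
move=> [tB _] tp; have t0 : t 0 by rewrite -(subrr p); exact: tB.
have tN q : t q -> t (- q) by move=> tq; rewrite -sub0r; exact: tB.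
have tn (n : nat) : t (p.1 *+ n, p.2 *+ n).
  elim: n => [|n IH]; first by rewrite !mulr0n.
  rewrite !mulrSr; have := tB _ _ IH (tN _ tp).
  by rewrite opprK.
case: k => n; first exact: tn.
rewrite NegzE !mulrNz; exact: (tN _ (tn n.+1)).
Qed.

(** The multiples of [x] in the domain of [t] form a cyclic subgroup. Divisibility of [D] gives a
    [d] compatible with the value at its generator; if the subgroup is trivial, any [d] will do. *)
Lemma graph_hom_step t x : graph_hom t -> t 0 ->
  exists d, graph_hom [set p | exists2 q, t q & exists k : int,
    p = (q.1 + x *~ k, q.2 + d *~ k)].
Proof.
move=> gt t0; have [tB t1] := gt.
have [d dE] : exists d, forall k c, t (x *~ k, c) -> c = d *~ k.
  pose P n := `[< (0 < n)%N /\ exists c, t (x *+ n, c) >].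
  have [exP|noP] := pselect (exists n, P n).
    case: (ex_minnP exP) => n /asboolP [n0 [c tc]] nmin.
    have [d dn] := divD _ c n0; exists d => k c' tc'.
    have := graph_homZ _ _ (k %/ n)%Z gt tc => /= tq.
    have := tB _ _ tc' tq.
    have -> : (x *~ k, c') - (x *+ n *~ (k %/ n)%Z, c *~ (k %/ n)%Z) =
        (x *~ (k %% n)%Z, c' - c *~ (k %/ n)%Z).
      congr pair => /=; rewrite {1}(divz_eq k n) mulrzDr [x *+ n]pmulrn -mulrzA [(n : int) * _]mulrC.
      by rewrite addrAC subrr add0r.
    have : (0 <= (k %% n)%Z)%R by rewrite modz_ge0 // -lt0n.
    have : ((k %% n)%Z < n)%R by rewrite ltz_pmod.
    rewrite [in c' = _](divz_eq k n).
    case: (k %% n)%Z => // -[|m] mn _ tm.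
      rewrite addr0 mulrC mulrzA -[d *~ n]pmulrn dn.
      by apply/eqP; rewrite -subr_eq0; apply/eqP/t1.
    suff : (n <= m.+1)%N by rewrite leqNgt -ltz_nat mn.
    by apply: nmin; apply/asboolP; split => //; eexists; exact: tm.
  exists 0 => k c; rewrite mul0rz.
  have noP' n c' : ~ t (x *+ n.+1, c').
    by move=> tn; apply: noP; exists n.+1; apply/asboolP; split=> //; exists c'.
  case: k => [[|n]|n]; first by rewrite mulr0z; exact: t1.
    by move/noP'.
  by move=> tn; have := graph_homZ _ _ (-1) gt tn => /=; rewrite NegzE !mulrNz opprK => /noP'.
exists d; split.
  move=> _ _ [p tp [k ->]] [q tq [l ->]].
  exists (p - q); first exact: tB.
  by exists (k - l); congr pair; rewrite /= mulrzBr opprD addrACA.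
move=> c [[a b] tab [k /= [a0 ->]]].
have : t (x *~ k, - b).
  have := tB _ _ t0 tab; rewrite sub0r.
  suff -> : x *~ k = - a by [].
  by apply/eqP; rewrite -addr_eq0 addrC -a0.
by move/dE => <-; rewrite subrr.
Qed.

Lemma graph_hom_extension r : graph_hom r -> r 0 ->
  exists2 F : G -> D, zmod_morphism F & forall x d, r (x, d) -> F x = d.
Proof.
move=> gr r0.
(* Zorn's lemma also covers the empty chain, whose union is empty; adjoining [r] makes the empty set
   admissible. *)
pose P s := graph_hom (r `|` s).
have [F FP Ftot|s [Ps maxs]] := @Zorn_bigcup _ P.
  split.
    move=> p q pU qU.
    have [[X FX [Xp Xq]]|[rp rq]] :
        (exists2 X, F X & (r `|` X) p /\ (r `|` X) q) \/ (r p /\ r q).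
      case: pU qU => [rp|[X FX Xp]] [rq|[Y FY Yq]].
      - by right.
      - by left; exists Y => //; split; [left|right].
      - by left; exists X => //; split; [right|left].
      - by case: (Ftot _ _ FX FY) => XY; left;
          [exists Y|exists X] => //; split; right => //; exact: XY.
      have [rX|XX] := (FP _ FX).1 _ _ Xp Xq; first by left.
      by right; exists X.
    by left; apply: gr.1.
  move=> d [|[X FX Xd]]; first exact: gr.2.
  by apply: (FP _ FX).2; right.
set t := r `|` s in Ps.
have t0 : t 0 by left.
have tot x : exists d, t (x, d).
  apply: contrapT => nx.
  have [d] := graph_hom_step t x Ps t0; set t' := (X in graph_hom X) => gt'.
  have tt' : t `<=` t'.
    by move=> [a b] tab; exists (a, b) => //; exists 0; rewrite !mulr0z !addr0.
  have t'x : t' (x, d) by exists 0 => //; exists 1; rewrite !mulr1z !add0r.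
  apply: (maxs t').
    split; first by move=> p sp; apply: tt'; right.
    by move=> t's; apply: nx; exists d; right; exact: t's.
  by rewrite /P setUidr // => p rp; apply: tt'; left.
pose F x := xget 0 [set d | t (x, d)].
have FE x : t (x, F x).
  have [d td] := tot x; exact: (@xgetI _ 0 [set d | t (x, d)] d td).
have F1 x d : t (x, d) -> F x = d.
  move=> td; apply/eqP; rewrite -subr_eq0; apply/eqP/Ps.2.
  by have := Ps.1 _ _ (FE x) td; rewrite -[0](subrr x).
exists F; last by move=> x d rx; apply: F1; left.
by move=> x y; apply: F1; exact: Ps.1 (FE x) (FE y).
Qed.

End HomExtension.

(** * Independence over finitely generated subgroups *)

Section Freeness.
Variables (G : zmodType) (e : nat -> G).

Definition subgroup (S : set G) := S 0 /\ forall x y, S x -> S y -> S (x - y).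

(* The classes of the [e i], i >= N, are independent of infinite order modulo [S]. *)
Definition free_mod (S : set G) (N : nat) :=
  forall M k, S (\sum_(N <= i < M) e i *~ k i) ->
    forall i, (N <= i < M)%N -> k i = 0.

Lemma sum_mulrz_pad (V : zmodType) (v : nat -> V) (k : nat -> int) N M M' :
  (M <= M')%N ->
  \sum_(N <= i < M) v i *~ k i =
  \sum_(N <= i < M') v i *~ (if (i < M)%N then k i else 0).
Proof.
move=> MM'; have [NM|MN] := leqP N M; last first.
  rewrite big_geq; last exact: ltnW.
  rewrite big_nat big1 // => i /andP[Ni _].
  by rewrite ltnNge (leq_trans (ltnW MN) Ni) mulr0z.
rewrite (big_cat_nat NM MM') /= [X in _ = _ + X]big_nat [X in _ = _ + X]big1.
  by rewrite addr0; apply: eq_big_nat => i /andP[_ ->].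
by move=> i /andP[Mi _]; rewrite ltnNge Mi mulr0z.
Qed.

Lemma subgroup_mulrz S x (k : int) : subgroup S -> S x -> S (x *~ k).
Proof.
move=> [S0 SB] Sx; have SN y : S y -> S (- y) by rewrite -sub0r; exact: SB.
have Sn (n : nat) : S (x *+ n).
  elim: n => [|n IH]; first by rewrite mulr0n.
  by rewrite mulrSr -[X in _ + X]opprK; apply: SB => //; exact: SN.
by case: k => n; [exact: Sn|rewrite NegzE mulrNz; exact/SN/Sn].
Qed.

Lemma free_mod_step S N g : subgroup S -> free_mod S N ->
  exists N', free_mod [set x | exists c : int, S (x - g *~ c)] N'.
Proof.
move=> sS fS; have [S0 SB] := sS; set S' := (X in free_mod X).
have [fS'|nf] := pselect (free_mod S' N); first by exists N.
have [M [k [[c Sc] [i0 Ni0 ki0]]]] : exists M k, S' (\sum_(N <= i < M) e i *~ k i) /\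
    exists2 i, (N <= i < M)%N & k i != 0.
  apply: contrapT => H; apply: nf => M k Sk i iM; apply: contrapT => /eqP ki.
  by apply: H; exists M, k; split => //; exists i.
have /andP[Ni iM] := Ni0; have NM : (N <= M)%N by exact: leq_trans Ni (ltnW iM).
(* Past the indices of one nontrivial relation [c * g = sum k_i e_i] mod [S],
   a second relation must have [c' = 0]: eliminate [g] between the two. *)
exists M => M' k' [c' Sc'] i /andP[Mi iM'].
have MM' : (M <= M')%N by exact: leq_trans Mi (ltnW iM').
(* Coefficients of [c'] times the first relation minus [c] times the second, where [g] has dropped
   out; at [i0] this is [k i0 * c'] with [k i0] nonzero. *)
pose l j := if (j < M)%N then k j * c' else - (k' j * c).
have c'0 : c' = 0.
  have : l i0 = 0.
    apply: (fS M') => /=; last by rewrite Ni (leq_trans iM).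
    have := SB _ _ (subgroup_mulrz _ _ c' sS Sc) (subgroup_mulrz _ _ c sS Sc').
    rewrite !mulrzBl -!mulrzA [c' * c]mulrC opprB addrA subrK !mulrz_suml.
    rewrite (big_cat_nat NM MM') /= -sumrN; congr (S (_ + _)); apply: eq_big_nat => j.
      by move=> /andP[_ jM]; rewrite /l jM mulrzA.
    by move=> /andP[Mj _]; rewrite /l ltnNge Mj /= mulrNz mulrzA.
  by rewrite /l iM => /eqP; rewrite mulf_eq0 (negPf ki0) => /eqP.
pose l' j := if (j < M)%N then 0 else k' j.
have -> : k' i = l' i by rewrite /l' ltnNge Mi.
apply: (fS M'); last by rewrite (leq_trans NM).
move: Sc'; rewrite c'0 mulr0z subr0 (big_cat_nat NM MM') /=.
rewrite [X in S (X + _)]big_nat [X in S (X + _)]big1 ?add0r.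
  rewrite (_ : \sum_(M <= i < M') _ = \sum_(M <= i < M') e i *~ l' i) //.
  by apply: eq_big_nat => j /andP[Mj _]; rewrite /l' ltnNge Mj.
by move=> j /andP[_ jM]; rewrite /l' jM mulr0z.
Qed.

Lemma free_mod_seq (s : seq G) : free_mod [set 0] 0 ->
  exists S N, [/\ subgroup S, {in s, forall g, S g} & free_mod S N].
Proof.
move=> f0; elim: s => [|g s [S [N [sS Ss fS]]]].
  exists [set 0], 0%N; split => //; split => // x y -> ->.
  by rewrite /= subrr.
have [N' fS'] := free_mod_step S N g sS fS.
have [S0 SB] := sS.
eexists; exists N'; split; last exact: fS'.
  split; first by exists 0; rewrite mulr0z subrr.
  move=> x y [c Sx] [d Sy]; exists (c - d).
  have := SB _ _ Sx Sy; rewrite mulrzBr !opprB addrACA [in X in _ -> X]addrACA.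
  by rewrite [- (g *~ c) - _]addrC.
move=> h; rewrite inE => /orP[/eqP ->|hs].
  by exists 1; rewrite mulr1z subrr.
by exists 0; rewrite mulr0z subr0; exact: Ss.
Qed.

Lemma independent_free (E : set G) : set_bij [set: nat] E e ->
  independent E -> (forall g, E g -> infinite_order g) -> free_mod [set 0] 0.
Proof.
move=> [eE einj _] [_ Eind] Einf M k /= sum0 i /= iM.
have einj' : injective e by move=> x y; apply: einj; rewrite inE.
(* Independence takes coefficients indexed by group elements, so [k] is transported along a left
   inverse of [e]. *)
have [f fe] : exists f : G -> nat, cancel e f.
  exists (fun g => xget 0%N [set n | e n = g]) => n; apply: xget_unique => //= m.
  exact: einj'.
pose F := [fset x in [seq e i | i <- index_iota 0 M]]%fset.
have FE : perm_eq F [seq e i | i <- index_iota 0 M].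
  apply: uniq_perm; rewrite ?fset_uniq ?map_inj_uniq ?iota_uniq // => x.
  by rewrite inE.
have := (Eind F (k \o f) _).1; rewrite (perm_big _ FE) big_map /=.
under eq_bigr do rewrite fe.
have FsE : [set` F] `<=` E.
  by move=> x /=; rewrite inE => /mapP[j _ ->]; exact: eE.
move=> /(_ FsE sum0 (e i)); rewrite inE map_f ?mem_index_iota // fe => /(_ isT).
have einf n : e i *+ n.+1 <> 0 by apply: Einf => //; exact: eE.
case: (k i) => [[|n]|n] //; first by move/einf.
by rewrite NegzE mulrNz => /eqP; rewrite oppr_eq0 => /eqP /einf.
Qed.

(** Freeness modulo [S] makes the assignment [0] on [S] and [v i] at [e i] single-valued on the
    subgroup generated; divisibility extends it to [G]. *)
Lemma free_mod_hom (D : zmodType) S N (v : nat -> D) :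
  (forall (n : nat) (d : D), (0 < n)%N -> exists d', d' *+ n = d) ->
  subgroup S -> free_mod S N ->
  exists F : G -> D, [/\ zmod_morphism F, forall x, S x -> F x = 0 &
    forall n, (N <= n)%N -> F (e n) = v n].
Proof.
move=> divD [S0 SB] fS.
pose r := [set p : G * D | exists M k, S (p.1 - \sum_(N <= i < M) e i *~ k i) /\
  p.2 = \sum_(N <= i < M) v i *~ k i].
have [||F FH Fr] := @graph_hom_extension G D divD r.
- split.
    move=> [x d] [y c] [M [k [/= Sx ->]]] [M' [k' [/= Sy ->]]] /=.
    pose m := maxn M M'.
    pose l (M : nat) (k : nat -> int) i := if (i < M)%N then k i else 0.
    exists m, (fun i => l M k i - l M' k' i) => /=.
    split.
      have := SB _ _ Sx Sy.
      rewrite (sum_mulrz_pad _ _ _ _ _ _ (leq_maxl M M')).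
      rewrite (sum_mulrz_pad _ _ _ _ _ _ (leq_maxr M M')) -/m.
      under [X in _ -> S (_ - X)]eq_bigr do rewrite mulrzBr.
      by rewrite sumrB !opprD !opprK addrACA.
    rewrite (sum_mulrz_pad _ _ _ _ _ _ (leq_maxl M M')).
    rewrite (sum_mulrz_pad _ _ _ _ _ _ (leq_maxr M M')) -/m -sumrB.
    by apply: eq_bigr => i _; rewrite mulrzBr.
  move=> d [M [k [/= Sx ->]]]; rewrite big_nat big1 // => i iM.
  have -> : k i = 0; last by rewrite mulr0z.
  apply: (fS M) => //; have := SB _ _ S0 Sx.
  by rewrite !sub0r opprK.
- by exists 0%N, (fun=> 0); rewrite !big_geq //= subr0.
exists F; split => //.
  by move=> x Sx; apply: Fr; exists 0%N, (fun=> 0); rewrite !big_geq //= subr0.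
move=> n Nn; apply: Fr; exists n.+1, (fun i => (i == n)%:R).
by rewrite !big_nat_recr //= eqxx !big_nat !big1 ?add0r ?mulr1z ?subrr //;
  move=> i /andP[_ /ltn_eqF ->]; rewrite mulr0z.
Qed.

End Freeness.

(** * The circle as a compact divisible group *)

Lemma separated_hausdorff (S C : topologicalType) (I : Type) (ev : I -> S -> C) :
  hausdorff_space C -> (forall i, continuous (ev i)) ->
  (forall p q, (forall i, ev i p = ev i q) -> p = q) -> hausdorff_space S.
Proof.
move=> hC cev sep p q pq; apply: sep => i; apply: hC => A B nA nB.
by have [z [Az Bz]] := pq _ _ (cev i p A nA) (cev i q B nB); exists (ev i z).
Qed.

Section CircleParam.
Variable R : realType.
Local Open Scope complex_scope.

Fact expi_subproof (t : R) : `|(cos t +i* sin t : R[i])| == 1.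
Proof. by rewrite normc_def /= cos2Dsin2 sqrtr1. Qed.

Definition expi (t : R) : circle R := Circle (expi_subproof t).

Lemma expiD s t : expi (s + t) = expi s + expi t.
Proof.
by apply/val_inj; rewrite /= cosD sinD; congr (_ +i* _); rewrite addrC.
Qed.

Lemma expi0 : expi 0 = 0.
Proof. by apply/val_inj; rewrite /= cos0 sin0. Qed.

Lemma expiMn t n : expi (t *+ n) = expi t *+ n.
Proof.
by elim: n => [|n IH]; rewrite ?mulr0n ?expi0 // !mulrS expiD IH.
Qed.

Lemma expi2pi : expi (pi *+ 2) = 0.
Proof. by apply/val_inj; rewrite /= cos2pi sin2pi. Qed.

Lemma expi_surj z : exists2 t, 0 <= t <= pi *+ 2 & expi t = z.
Proof.
case: z => -[x y] xy1.
have xyE : x ^+ 2 + y ^+ 2 = 1.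
  move: (xy1); rewrite normc_def /= => /eqP [] H.
  by rewrite -[LHS]sqr_sqrtr ?H ?expr1n // addr_ge0 // sqr_ge0.
have x1 : -1 <= x <= 1.
  by rewrite -ler_norml -(@ler_pXn2r _ 2) ?nnegrE // real_normK ?num_real // expr1n
    -xyE lerDl sqr_ge0.
have sE : sin (acos x) = `|y|.
  by rewrite sin_acos // -xyE addrAC subrr add0r sqrtr_sqr.
have cE : cos (acos x) = x by rewrite acosK // in_itv.
have a0 := acos_ge0 x1; have api := acos_lepi x1.
have [y0|y0] := leP 0 y.
  exists (acos x); last by apply/val_inj; rewrite /= cE sE ger0_norm.
  by rewrite a0 (le_trans api) // mulr2n lerDl pi_ge0.
(* [acos] only reaches the upper half circle; the lower half is its reflection. *)
exists (pi *+ 2 - acos x).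
  rewrite subr_ge0 gerBl a0 andbT (le_trans api) // mulr2n lerDl pi_ge0 //.
apply/val_inj; rewrite /= cosB sinB cos2pi sin2pi !mul1r !mul0r addr0 sub0r cE sE.
by rewrite ltr0_norm // opprK.
Qed.

Lemma real_complex_continuous : continuous (fun x : R => x%:C : R[i]^o).
Proof.
move=> x; apply/cvgrPdist_lt => eps eps0.
(* A positive element of [R[i]] is real, so the estimate can be made in [R]. *)
have [Im0 Re0] : complex.Im eps = 0 /\ 0 < complex.Re eps.
  by move: eps0; rewrite ltcE => /andP[/eqP ? ?].
have -> : eps = (complex.Re eps)%:C by rewrite [LHS]complexE Im0 mulr0 addr0.
near=> y; rewrite -rmorphB normc_def /= expr0n addr0 sqrtr_sqr ltcR.
by near: y; exact: cvgr_dist_lt.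
Unshelve. all: by end_near. Qed.

Lemma expi_continuous : continuous expi.
Proof.
apply: continuous_circle => t.
have -> : (@circle_val R \o expi : R -> R[i]^o) =
    (fun t => (cos t)%:C + 'i * (sin t)%:C).
  by apply/funext => s; rewrite [LHS]complexE.
apply: (@cvgD R[i] R[i]^o).
  apply: (@continuous_comp _ _ _ (@cos R) (fun x : R => x%:C : R[i]^o)).
    exact: continuous_cos.
  exact: real_complex_continuous.
apply: (@cvgM R[i]); first exact: cvg_cst.
apply: (@continuous_comp _ _ _ (@sin R) (fun x : R => x%:C : R[i]^o)).
  exact: continuous_sin.
exact: real_complex_continuous.
Qed.

Lemma circle_compact : compact [set: circle R].
Proof.
rewrite (_ : [set: _] = expi @` `[0, pi *+ 2]).
  apply: continuous_compact; last exact: segment_compact.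
  exact/continuous_subspaceT/expi_continuous.
rewrite eqEsubset; split => // z _; have [t tI <-] := expi_surj z.
by exists t => //=; rewrite in_itv.
Qed.

Lemma circle_divisible (n : nat) (z : circle R) :
  (0 < n)%N -> exists z', z' *+ n = z.
Proof.
move=> n0; have [t _ <-] := expi_surj z; exists (expi (t / n%:R)).
by rewrite -expiMn -[_ *+ n]mulr_natr divfK // pnatr_eq0 -lt0n.
Qed.

Lemma circle_hausdorff : hausdorff_space (circle R).
Proof.
apply: (@separated_hausdorff _ R[i]^o unit (fun=> @circle_val R)).
- exact: norm_hausdorff.
- by move=> _; exact: circle_val_continuous.
- by move=> p q /(_ tt) /val_inj.
Qed.

End CircleParam.

(** * Powers of the dual group *)

(* [S] carries the initial topology of the family [ev], in terms of filters. *)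
Definition initial_family {S C : topologicalType} {I : Type} (ev : I -> S -> C) :=
  forall (F : set_system S) (f : S), Filter F ->
    (forall i, ev i @ F --> ev i f) -> F --> f.

Lemma initial_topology_cvg (S : choiceType) (C : topologicalType) (u : S -> C)
    (F : set_system S) (f : S) : Filter F -> u @ F --> u f ->
  F --> (f : initial_topology u).
Proof.
move=> FF cu A /= [_ [[B oB <-] Bf BA]].
have := cu B (open_nbhs_nbhs (conj oB Bf)).
by apply: (@filterS _ F) => g Bg; exact: BA.
Qed.

Lemma ptws_initial (I : Type) (C : topologicalType) :
  initial_family (fun i (f : {ptws I -> C}) => f i).
Proof.
move=> F f FF cF; apply/cvg_sup => i A /= [_ [[B oB <-] Bf BA]].
have := cF i B (open_nbhs_nbhs (conj oB Bf)).
by apply: (@filterS _ F) => g Bg; exact: BA.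
Qed.

Lemma ptws_proj_continuous (I : Type) (C : topologicalType) (i : I) :
  continuous (fun f : {ptws I -> C} => f i).
Proof.
move=> f; have /cvg_sup/(_ i) cf : f --> f by exact: cvg_id.
move=> A /(@initial_continuous {ptws I -> C} C (fun f => f i) f) nA.
exact: cf.
Qed.

Lemma initial_family_support {S C : topologicalType} {I : eqType}
    {ev : I -> S -> C} {f : S} {A : set S} :
  initial_family ev -> nbhs f A ->
  exists (s : seq I) (B : I -> set C), (forall i, open_nbhs (ev i f) (B i)) /\
    forall g, {in s, forall i, B i (ev i g)} -> A g.
Proof.
move=> iev.
(* The sets with the required property form a filter, which converges to [f]. *)
pose Phi : set_system S := fun A => exists (s : seq I) (B : I -> set C),
  (forall i, open_nbhs (ev i f) (B i)) /\
  forall g, {in s, forall i, B i (ev i g)} -> A g.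
have FPhi : Filter Phi.
  split.
  - exists [::], (fun=> setT); split => // i; split => //; exact: openT.
  - move=> P Q [s [B [oB BP]]] [t [D [oD DQ]]].
    exists (s ++ t), (fun i => B i `&` D i); split.
      by move=> i; have [? ?] := oB i; have [? ?] := oD i; split; [exact: openI|].
    move=> g stg; split.
      by apply: BP => i si; have [] := stg i; rewrite // mem_cat si.
    by apply: DQ => i ti; have [] := stg i; rewrite // mem_cat ti orbT.
  - move=> P Q PQ [s [B [oB BP]]]; exists s, B; split => // g sg.
    by apply: PQ; exact: BP.
apply: (iev Phi f) => i D nD.
exists [:: i], (fun j => if j == i then D^° else setT); split.
  move=> j; case: eqP => [->|_]; first by split; [exact: open_interior|].
  by split; [exact: openT|].
move=> g /(_ i); rewrite inE eqxx => /(_ isT) Dg.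
exact: (interior_subset Dg).
Qed.

Lemma near_seq (T : Type) (F : set_system T) (I : eqType) (s : seq I)
    (P : I -> T -> Prop) : Filter F ->
  (forall i, i \in s -> \forall x \near F, P i x) ->
  \forall x \near F, {in s, forall i, P i x}.
Proof.
move=> FF; elim: s => [|i s IH] sP; first by apply: filterE.
have Pi := sP i (mem_head _ _).
have {}IH : \forall x \near F, {in s, forall i, P i x}.
  by apply: IH => j js; apply: sP; rewrite inE js orbT.
near=> x => j; rewrite inE => /orP[/eqP ->|]; first by near: x.
by move: j; near: x.
Unshelve. all: by end_near. Qed.

Section DualPower.
Variables (R : realType) (Gamma : zmodType).
Let X := {ptws circle R -> discrete_dual R Gamma}.

Definition dual_eval (p : circle R * Gamma) (h : X) : circle R :=
  set_val (h p.1) p.2.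

Lemma dual_eval_initial : initial_family dual_eval.
Proof.
move=> F f FF cF; apply: ptws_initial => t.
apply: (initial_topology_cvg _ _ (set_val :
  set_type (@Defs.Hom Gamma (circle R) : set {ptws Gamma -> circle R}) -> {ptws Gamma -> circle R})).
apply: ptws_initial => g; exact: (cF (t, g)).
Qed.

Lemma dual_eval_continuous p : continuous (dual_eval p).
Proof.
move=> h; apply: (@continuous_comp X (discrete_dual R Gamma) (circle R)
  (fun h => h p.1) (fun f => set_val f p.2)).
  exact: ptws_proj_continuous.
apply: (@continuous_comp (discrete_dual R Gamma) {ptws Gamma -> circle R} (circle R)
  set_val (fun f => f p.2)); last exact: ptws_proj_continuous.
exact: (@initial_continuous _ {ptws Gamma -> circle R}).
Qed.

Lemma dual_power_hausdorff : hausdorff_space X.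
Proof.
apply: (separated_hausdorff _ _ _ dual_eval) => //.
- exact: circle_hausdorff.
- exact: dual_eval_continuous.
move=> p q pq; apply/funext => t; apply/val_inj/funext => g.
exact: (pq (t, g)).
Qed.

(** Along an ultrafilter every coordinate converges, the circle being compact, and the limits are
    additive in the group element by uniqueness of limits. *)
Lemma dual_power_compact : compact [set: X].
Proof.
rewrite compact_ultra => F UF _.
have lim p : exists z : circle R, dual_eval p @ F --> z.
  have := @circle_compact R; rewrite compact_ultra.
  have UpF : UltraFilter (dual_eval p @ F).
    split=> [|G PG FG]; first exact: fmap_proper_filter.
    rewrite eqEsubset; split=> // A GA; apply: contrapT => nA.
    have [FA|FnA] := in_ultra_setVsetC (dual_eval p @^-1` A) UF; first exact: nA.
    have /filter_ex [x [Ax nAx]] : G (A `&` ~` A) by apply: filterI => //; exact: FG.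
    exact: nAx.
  by move=> /(_ _ UpF filterT) [z [_ ?]]; exists z.
have /choice [l lP] := lim.
have lH t : Defs.Hom (fun g => l (t, g)).
  move=> g h; apply: (@cvg_unique _ (@circle_hausdorff R) (dual_eval (t, g - h) @ F)).
    exact: lP.
  have -> : dual_eval (t, g - h) = (fun f => dual_eval (t, g) f - dual_eval (t, h) f).
    by apply/funext => f; exact: (set_mem (svalP (f t))).
  apply: (@continuous2_cvg _ _ _ _ _ _ _ _ (fun x y : circle R => x - y));
    [|exact: lP|exact: lP].
  exact: (@sub_continuous (circle R) (l (t, g), l (t, h))).
exists (fun t => exist (fun g => g \in _) _ (mem_set (lH t))); split => //.
by apply: dual_eval_initial => -[t g]; exact: lP.
Qed.

End DualPower.

(** * Finite subgroups of the power of the circle *)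

(** Holds once [j] exceeds [x]; it keeps the cell number of a fixed point within the range of [lam]
    below. *)
Lemma near_truncn_le (R : realType) (x : R) :
  \forall j \near \oo, (Num.truncn (x * j%:R) <= j * j)%N.
Proof.
exists (Num.truncn x).+1 => // j /= xj; rewrite truncn_le_nat.
apply: (@le_lt_trans _ _ (j * j)%:R); last by rewrite ltr_nat.
by rewrite natrM ler_wpM2r // (le_trans (ltW (truncnS_gt x))) // ler_nat.
Qed.

(** Once [j > 1 / (y - x)] the two multiples are more than 1 apart, so distinct points end up in
    distinct cells. *)
Lemma near_truncn_lt (R : realType) (x y : R) : 0 <= x -> x < y ->
  \forall j \near \oo, (Num.truncn (x * j%:R) < Num.truncn (y * j%:R))%N.
Proof.
move=> x0 xy; have yx0 : 0 < y - x by rewrite subr_gt0.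
exists (Num.truncn (y - x)^-1).+1 => // j /= jxy.
have y0 : 0 <= y by rewrite (le_trans x0) // ltW.
have : 1 < (y - x) * j%:R.
  rewrite -ltr_pdivrMl // mulr1.
  by rewrite (lt_le_trans (truncnS_gt _)) // ler_nat.
rewrite mulrBl ltrBrDl truncn_gt_nat => H.
have /andP[H1 _] := truncn_itv (mulr_ge0 x0 (ler0n R j)).
by rewrite -natr1 (le_trans _ (ltW H)) // lerD2r.
Qed.

Lemma truncn_grid_cvg (R : realType) (c x : R) : 0 < c -> 0 <= x ->
  (c / j.+1%:R) *+ Num.truncn (x * j.+1%:R / c) @[j --> \oo] --> x.
Proof.
move=> c0 x0.
have lower : x - c * harmonic j @[j --> \oo] --> x.
  rewrite -[X in _ --> X]subr0; apply: cvgB; first exact: cvg_cst.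
  by rewrite -(mulr0 c); apply: cvgM; [exact: cvg_cst|exact: cvg_harmonic].
apply: (squeeze_cvgr _ lower (cvg_cst x)).
apply: nearW => j; rewrite /harmonic -[_ *+ Num.truncn _]mulr_natr.
have j0 : 0 < j.+1%:R :> R by rewrite ltr0n.
have /truncn_itv /andP[] : 0 <= x * j.+1%:R / c.
  by rewrite divr_ge0 ?mulr_ge0 // ltW.
set n := Num.truncn _; rewrite ler_pdivlMr // ltr_pdivrMr // => H1 H2.
apply/andP; split.
  rewrite lerBlDr -[X in _ + X]mulr1 -mulrDr natr1 mulrAC ler_pdivlMr //.
  by rewrite (le_trans (ltW H2)) // mulrC.
by rewrite mulrAC ler_pdivrMr // mulrC.
Qed.

Section FiniteApproximation.
Variable R : realType.
Let K : topologicalZmodType := {ptws circle R -> circle R}.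

(* Reindexing the sum by [sh] multiplies it by [chi c <> 1]. *)
Lemma sum_character_eq0 (A : finType) (phi : A -> K) (chi : K -> circle R)
    (sh : A -> A) (c : K) :
  injective sh -> (forall a, phi (sh a) = phi a + c) -> zmod_morphism chi ->
  chi c <> 0 ->
  \sum_a (chi (phi a) : R[i]) = 0.
Proof.
move=> sh_inj phi_sh chiH chic; set S := \sum_a _.
have chiD x y : chi (x + y) = chi x + chi y.
  have chi0 : chi 0 = 0 by rewrite -(subrr 0) chiH subrr.
  by rewrite -[in LHS](opprK y) -[in LHS](sub0r y) !chiH chi0 sub0r opprK.
have : S = S * chi c.
  rewrite {1}/S (reindex_inj sh_inj) mulr_suml.
  by apply: eq_bigr => a _; rewrite phi_sh chiD circleD.
move/eqP; rewrite -subr_eq0 -{1}(mulr1 S) -mulrBr mulf_eq0 => /orP[/eqP //|].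
by rewrite subr_eq0 => /eqP c1; case: chic; apply/val_inj; rewrite /= -c1.
Qed.

Lemma mulrn_modn (V : zmodType) (u : V) q n : u *+ q = 0 -> u *+ (n %% q) = u *+ n.
Proof. by move=> uq; rewrite [in RHS](divn_eq n q) mulrnDr mulnC mulrnA uq mul0rn add0r. Qed.

(** A nontrivial [chi] is nontrivial on an open set, which restricts finitely many coordinates only;
    for large [j] the image of [phi j] meets it, and translation by such an element kills the sum.
    The lists may repeat values, since the translation acts on the indexing functions. *)
Lemma finite_approximation : exists Y : nat -> seq K,
  (forall j, (0 < size (Y j))%N) /\
  forall chi : K -> circle R, characters chi -> chi <> (fun=> 0) ->
    \forall j \near \oo, \sum_(y <- Y j) (chi y : R[i]) = 0.
Proof.
have /choice[theta thetaP] : forall z : circle R, exists t, 0 <= t /\ expi R t = z.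
  by move=> z; have [t /andP[t0 _] <-] := expi_surj R z; exists t.
have theta0 z : 0 <= theta z by have [] := thetaP z.
have thetaK z : expi R (theta z) = z by have [] := thetaP z.
have tpi0 : 0 < pi *+ 2 :> R by rewrite pmulrn_rgt0 // pi_gt0.
(* [inord] falls back to [0] beyond [j * j]; for a fixed [t] this ceases for large [j], and no bound
   uniform in [t] is required. *)
pose lam j (t : circle R) : 'I_(j * j).+1 := inord (Num.truncn (theta t * j%:R)).
pose u j := expi R (pi *+ 2 / j.+1%:R).
have uj j : u j *+ j.+1 = 0.
  by rewrite -expiMn -[_ *+ j.+1]mulr_natr divfK ?pnatr_eq0 // expi2pi.
(* Rounding down to a root of unity; the reduction modulo [j.+1] in [inZp] is harmless because
   [u j *+ j.+1 = 0]. *)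
pose kap j (z : circle R) : 'I_j.+1 := inZp (Num.truncn (theta z * j.+1%:R / (pi *+ 2))).
have kapP z : u j *+ kap j z @[j --> \oo] --> z.
  rewrite (_ : (fun j => _) = expi R \o
      (fun j => (pi *+ 2 / j.+1%:R) *+ Num.truncn (theta z * j.+1%:R / (pi *+ 2)))).
    rewrite -[X in _ --> X]thetaK; apply: continuous_cvg; first exact: expi_continuous.
    exact: truncn_grid_cvg.
  by apply/funext => j; rewrite /= mulrn_modn // -expiMn.
(* The map [theta] is an injection into the reals, cut by [lam j] into cells of
   length 1 / j; [phi j] embeds the functions from cells to (j+1)-th roots of unity. *)
pose phi j (a : {ffun 'I_(j * j).+1 -> 'I_j.+1}) : K := fun t => u j *+ a (lam j t).
have phiD j : {morph phi j : x y / x + y}.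
  by move=> a b; apply/funext => t; rewrite /phi ffunE /= mulrn_modn // mulrnDr.
exists (fun j => [seq phi j a | a <- enum {: {ffun 'I_(j * j).+1 -> 'I_j.+1}}]); split.
  by move=> j; rewrite size_map -cardE; apply/card_gt0P; exists 0.
move=> chi [chiC chiH] chi1.
have [f chif] : exists f, chi f <> 0.
  by apply: contrapT => H; apply: chi1; apply/funext => f; apply: contrapT => ?; apply: H; exists f.
have nf : nbhs f [set g | chi g <> 0].
  apply: (chiC f [set z | z <> 0]); apply: open_nbhs_nbhs; split => //.
  rewrite (_ : [set z | _] = ~` [set 0]) //; apply: closed_openC.
  exact/accessible_closed_set1/hausdorff_accessible/circle_hausdorff.
have [F [B [oB FB]]] := initial_family_support (ptws_initial _ _) nf.
have near1 : \forall j \near \oo, {in F, forall t, B t (u j *+ kap j (f t))}.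
  by apply: near_seq => t _; apply: (kapP (f t)); exact: open_nbhs_nbhs.
have near2 : \forall j \near \oo, {in F, forall t, {in F, forall s,
    lam j t = lam j s -> t = s}}.
  apply: near_seq => t _; apply: near_seq => s _.
  have [->|/eqP ts] := eqVneq t s; first exact: nearW.
  have nts : theta t != theta s.
    by apply: contra_notN ts => /eqP e; rewrite -(thetaK t) e thetaK.
  have nn : \forall j \near \oo, Num.truncn (theta t * j%:R) != Num.truncn (theta s * j%:R).
    move: nts; rewrite neq_lt => /orP[] ts'.
      by apply: filterS (near_truncn_lt _ _ _ (theta0 t) ts') => j; rewrite neq_ltn => ->.
    by apply: filterS (near_truncn_lt _ _ _ (theta0 s) ts') => j; rewrite neq_ltn orbC => ->.
  have nt := near_truncn_le _ (theta t); have ns := near_truncn_le _ (theta s).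
  near=> j => /(congr1 val); rewrite /= !inordK ?ltnS; last 2 first.
  - by near: j.
  - by near: j.
  by move/eqP => e; exfalso; move: e; apply/negP; near: j.
near=> j; rewrite big_map big_enum /=.
(* On each cell, [b] approximates [f] at the coordinate of [F] lying there, unique for large [j];
   cells without one get the default of [head]. *)
pose b : {ffun 'I_(j * j).+1 -> 'I_j.+1} :=
  [ffun l => kap j (f (head 0 [seq t <- F | lam j t == l]))].
apply: (sum_character_eq0 _ (phi j) chi (fun a => a + b) (phi j b)) => //.
  exact: addIr.
  by move=> a; exact: phiD.
apply: (FB (phi j b)) => t tF; rewrite /phi ffunE.
set s := [seq _ <- F | _].
have : head 0 s \in s.
  have : t \in s by rewrite mem_filter eqxx.
  by case: (s) => //= x s' _; rewrite mem_head.
rewrite mem_filter => /andP[/eqP lE hF].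
have -> : head 0 s = t by apply: (near near2 j).
exact: (near near1 j).
Unshelve. all: by end_near. Qed.

End FiniteApproximation.

(** * Weak uniform distribution along blocks *)

Lemma block_concatenation (T : Type) (x0 : T) (Y : nat -> seq T) :
  (forall i, (0 < size (Y i))%N) ->
  exists (y : nat -> T) (a b : nat -> nat),
    (forall i, [/\ (i <= a i)%N, (a i < b i)%N & (a i * i.+1 <= b i)%N]) /\
    forall (V : zmodType) (f : T -> V) i, \sum_(x <- Y i) f x = 0 ->
      \sum_(a i <= n < b i) f (y n) = 0.
Proof.
move=> Y0.
(* That many copies make the new part longer than [i.+1] times all that precedes; the extra copy
   keeps it nonempty when [l] is. *)
pose rep i (l : seq T) := flatten (nseq (size l * i.+1).+1 (Y i)).
have sz_rep i l : (size l * i.+1 < size (rep i l))%N.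
  rewrite size_flatten /shape map_nseq sumn_nseq.
  by rewrite -[X in (X <= _)%N]mul1n leq_mul.
pose s := fix s n := if n is i.+1 then s i ++ rep i (s i) else [::].
have sS i : s i.+1 = s i ++ rep i (s i) by [].
have szS i : size (s i.+1) = (size (s i) + size (rep i (s i)))%N by rewrite sS size_cat.
have lt_sz i : (size (s i) < size (s i.+1))%N.
  by rewrite szS -[X in (X < _)%N]addn0 ltn_add2l (leq_ltn_trans _ (sz_rep _ _)).
have le_sz i : (i <= size (s i))%N.
  by elim: i => // i IH; exact: leq_ltn_trans (lt_sz i).
have nth_s i d n : (n < size (s i))%N -> nth x0 (s (i + d)%N) n = nth x0 (s i) n.
  move=> ni; elim: d => [|d IH]; first by rewrite addn0.
  rewrite addnS sS nth_cat IH ifT //.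
  apply: (leq_trans ni); elim: d {IH} => [|d IH]; first by rewrite addn0.
  by rewrite addnS (leq_trans IH) // ltnW.
(* The stages extend one another and [s n.+1] has more than [n] terms, so the [n]-th term may be
   read off in any stage that reaches it. *)
have y_s i n : (n < size (s i))%N -> nth x0 (s n.+1) n = nth x0 (s i) n.
  move=> ni; have [le|/ltnW le] := leqP i n.+1.
    by rewrite -(subnKC le) nth_s.
  by rewrite -(subnKC le) nth_s.
exists (fun n => nth x0 (s n.+1) n), (fun i => size (s i)), (fun i => size (s i.+1)).
split.
  move=> i; split => //.
  by rewrite szS (leq_trans (ltnW (sz_rep i (s i)))) // leq_addl.
move=> V f i Yi0.
rewrite (eq_big_nat _ _ (F2 := fun n => f (nth x0 (s i.+1) n))); last first.
  by move=> n /andP[_ ni]; rewrite (y_s i.+1).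
have : \sum_(x <- rep i (s i)) f x = 0.
  rewrite /rep; elim: (_.+1) => [|c IH]; first by rewrite big_nil.
  by rewrite /= big_cat /= Yi0 IH addr0.
rewrite (big_nth x0) szS => rep0; rewrite -[RHS]rep0.
rewrite -{1}[size (s i)]add0n big_addn addKn; apply: eq_big_nat => n _.
by rewrite sS nth_cat ltnNge leq_addl /= addnK.
Qed.

Lemma norm_circle (R : realType) (z : circle R) : `|(z : R[i])| = 1.
Proof. exact/eqP/circle_norm. Qed.

(** The average is taken up to the end of a late block: the terms before the block are a negligible
    fraction, and on the block [chi (x n)] is close to [chi (y n)], whose sum vanishes. Infinitely
    many good blocks suffice, as only one [N] is sought for each [k]. *)
Lemma weakly_ud_of_blocks (R : realType) (K : topologicalZmodType)
    (x y : nat -> K) (i a b : nat -> nat) :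
  (forall j, (j <= i j)%N) ->
  (forall k, (a k < b k)%N /\ (a k * k.+1 <= b k)%N) ->
  (forall chi : K -> circle R, characters chi -> chi <> (fun=> 0) ->
    \forall k \near \oo, \sum_(a k <= n < b k) (chi (y n) : R[i]) = 0) ->
  (forall U, nbhs (0 : K) U ->
    \forall j \near \oo, forall n, (a (i j) <= n < b (i j))%N -> U (x n - y n)) ->
  weakly_uniformly_distributed R x.
Proof.
move=> ji ab chi_y xy chi chich chi1 k k0.
have [chiC chiH] := chich.
have chi0 : chi 0 = 0 by rewrite -(subrr 0) chiH subrr.
(* The initial terms and the error on the block each cost at most [d] on average; the third share of
   [k%:R^-1] makes the inequality strict. *)
pose d : R[i] := (3 * k)%:R^-1.
have d0 : 0 < d by rewrite invr_gt0 ltr0n muln_gt0.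
have /xy nearU : nbhs (0 : K) [set u | `|(chi u : R[i]) - 1| < d].
  have cc : {for 0, continuous ((@circle_val R : circle R -> R[i]^o) \o chi)}.
    by apply: continuous_comp; [exact: chiC|exact: circle_val_continuous].
  have /cvgrPdist_lt/(_ _ d0) := cc; rewrite /= chi0 circle0.
  by apply: filterS => u; rewrite distrC.
have [N1 _ HN1] := chi_y _ chich chi1; have [N2 _ HN2] := nearU.
pose j := maxn (maxn N1 N2) (3 * k).
pose q := i j.
have jq : (j <= q)%N := ji j.
have N1q : (N1 <= q)%N by rewrite (leq_trans _ jq) // !leq_max leqnn.
have kq : (3 * k <= q)%N by rewrite (leq_trans _ jq) // !leq_max leqnn !orbT.
have N2j : (N2 <= j)%N by rewrite !leq_max leqnn orbT.
have [aq_bq aq_le] := ab q.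
have b0 : (0 < b q)%N by exact: leq_ltn_trans aq_bq.
exists (b q) => //.
have bR0 : 0 < (b q)%:R :> R[i] by rewrite ltr0n.
rewrite normrM gtr0_norm ?invr_gt0 // mulrC ltr_pdivrMr //.
have -> : \sum_(n < b q) (chi (x n) : R[i]) = \sum_(0 <= n < a q) (chi (x n) : R[i]) +
    \sum_(a q <= n < b q) (circle_val (chi (x n)) - circle_val (chi (y n))).
  rewrite sumrB (HN1 q) // subr0 -(big_mkord xpredT (fun n => chi (x n) : R[i])).
  by rewrite (big_cat_nat (n := a q)) // ltnW.
apply: (@le_lt_trans _ _ ((a q)%:R + (b q)%:R * d)).
  apply: (le_trans (ler_normD _ _)); apply: lerD.
    apply: (le_trans (ler_norm_sum _ _ _)).
    by rewrite (eq_bigr (fun=> 1)) ?sumr_const_nat ?subn0 // => n _; rewrite norm_circle.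
  apply: (le_trans (ler_norm_sum _ _ _)).
  apply: (@le_trans _ _ (\sum_(a q <= n < b q) d)); last first.
    rewrite sumr_const_nat -[d *+ _]mulr_natl; apply: ler_wpM2r; first exact: ltW.
    by rewrite ler_nat leq_subr.
  rewrite big_nat [leRHS]big_nat; apply: ler_sum => n nab; apply: ltW.
  have := HN2 j N2j n nab; rewrite /= chiH circleD circleN.
  have -> : circle_val (chi (x n)) - circle_val (chi (y n)) =
      (circle_val (chi (x n)) / circle_val (chi (y n)) - 1) * circle_val (chi (y n)).
    by rewrite mulrBl mul1r divfK // circle_neq0.
  by rewrite normrM norm_circle mulr1.
have -> : k%:R^-1 * (b q)%:R = (b q)%:R * d *+ 3 :> R[i].
  rewrite -mulrnAr mulrC; congr (_ * _).
  by rewrite /d natrM invfM -[RHS]mulr_natr mulrAC mulVf ?mul1r // pnatr_eq0.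
rewrite [X in _ < X]mulrSr ltrD2r.
apply: (@le_lt_trans _ _ ((b q)%:R * d)).
  rewrite ler_pdivlMr ?ltr0n ?muln_gt0 // -natrM ler_nat (leq_trans _ aq_le) //.
  by rewrite leq_mul2l (leq_trans kq) ?orbT.
by rewrite mulr2n ltrDl mulr_gt0.
Qed.

(** * The generic point *)

Section NearZero.
Variable R : realType.

Definition near_zero (j : nat) : set (circle R) :=
  [set z | `|(z : R[i]) - 1| < j.+1%:R^-1].

Lemma near_zero0 j : near_zero j 0.
Proof. by rewrite /near_zero /= subrr normr0 invr_gt0 ltr0n. Qed.

Lemma open_near_zero j : open (near_zero j).
Proof.
have := @circle_val_continuous R.
move=> /continuousP /(_ (ball (1 : R[i]^o) j.+1%:R^-1)).
rewrite (_ : _ @^-1` _ = near_zero j); last first.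
  by rewrite eqEsubset; split => z; rewrite /ball /= distrC.
by apply; apply: ball_open; rewrite invr_gt0 ltr0n.
Qed.

Lemma near_zero_basis (B : set (circle R)) : nbhs 0 B ->
  \forall j \near \oo, near_zero j `<=` B.
Proof.
move=> [_ [[D oD <-] D0 DB]].
have /nbhs_ballP [eps /= eps0 epsD] : nbhs (1 : R[i]^o) D by exact: open_nbhs_nbhs.
have [Im0 Re0] : complex.Im eps = 0 /\ 0 < complex.Re eps.
  by move: eps0; rewrite ltcE => /andP[/eqP ? ?].
near=> j => z; rewrite /near_zero /= => zj; apply: DB; apply: epsD.
rewrite /ball /= distrC (lt_trans zj) // ltcE /=.
have -> : (j.+1%:R^-1 : R[i]) = (j.+1%:R^-1 : R)%:C%C by rewrite fmorphV rmorph_nat.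
rewrite /= Im0 eqxx /=.
by near: j; exact: near_infty_natSinv_lt (PosNum Re0).
Unshelve. all: by end_near. Qed.

End NearZero.

Lemma open_seq_forall (S : topologicalType) (I : eqType) (s : seq I)
    (A : I -> set S) : (forall i, i \in s -> open (A i)) ->
  open [set x | {in s, forall i, A i x}].
Proof.
move=> oA; rewrite openE => x Ax; apply: near_seq => i si.
by have := oA i si; rewrite openE; apply; exact: Ax.
Qed.

Lemma nested_closure_meet (S : topologicalType) (V : nat -> set S) :
  compact [set: S] -> (forall n, V n !=set0) -> (forall n, V n.+1 `<=` V n) ->
  exists x, forall n, closure (V n) x.
Proof.
move=> cS V0 VS.
have Vle m n : (m <= n)%N -> V n `<=` V m.
  move/subnKC <-; elim: (n - m)%N => [|d IH]; first by rewrite addn0.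
  by rewrite addnS; apply: subset_trans IH; exact: VS.
have PF : ProperFilter (filter_from [set: nat] V).
  apply: filter_from_proper => [|n _]; last exact: V0.
  apply: filter_from_filter; first by exists 0%N.
  move=> i j _ _; exists (maxn i j) => // x Vx.
  by split; apply: Vle Vx; rewrite ?leq_maxl ?leq_maxr.
have [|x [_ Fx]] := cS _ PF; first by exists 0%N.
by exists x => n B nB; apply: Fx => //; exists n.
Qed.

Lemma continuous_subr_cst (S : topologicalType) (G : topologicalZmodType)
  (f : S -> G) (c : G) : continuous f -> continuous (fun x => f x - c).
Proof.
move=> cf x; apply: (@continuous2_cvg _ _ _ _ _ _ _ _ (fun u v : G => u - v));
  [|exact: cf|exact: cvg_cst].
exact: (@sub_continuous G (_, _)).
Qed.

Section Construction.
Variables (R : realType) (Gamma : zmodType) (e : nat -> Gamma).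
Hypothesis e_free : free_mod Gamma e [set 0] 0.
Variables (y : nat -> circle R -> circle R) (a b : nat -> nat).
Hypothesis ia : forall i, (i <= a i)%N.
Let X := {ptws circle R -> discrete_dual R Gamma}.
Local Notation ev := (dual_eval R Gamma).

(** A rectangle rather than a set of pairs: [T] collects the coordinates to be brought close to [y],
    [G] the elements at which a change of tail must preserve values. *)
Definition supported (V : set X) (T : seq (circle R)) (G : seq Gamma) :=
  forall f f', {in T & G, forall t g, ev (t, g) f = ev (t, g) f'} -> V f -> V f'.

(** A compact Hausdorff space is regular, and inside the smaller neighbourhood there is a basic open
    set. *)
Lemma open_supported_shrink (O : set X) f : open O -> O f ->
  exists V T G, [/\ open V, V f, closure V `<=` O & supported V T G].
Proof.
move=> oO Of.
have [A nA AO] : exists2 A, nbhs f A & closure A `<=` O.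
  apply: (compact_regular (dual_power_hausdorff R Gamma) (dual_power_compact R Gamma)).
    exact: filterT.
  exact: open_nbhs_nbhs.
have [s [B [oB BA]]] := initial_family_support (dual_eval_initial R Gamma) nA.
exists [set g | {in s, forall p, B p (ev p g)}], (map fst s), (map snd s); split.
- apply: (open_seq_forall _ _ s (fun p => ev p @^-1` B p)) => p _.
  have /continuousP := dual_eval_continuous R Gamma p.
  by apply; have [] := oB p.
- by move=> p _; have [] := oB p.
- by apply: subset_trans AO; apply: closure_subset => g; exact: BA.
- move=> g g' gg' Bg [t h] ps.
  have tT : t \in map fst s by apply/mapP; exists (t, h).
  have hG : h \in map snd s by apply/mapP; exists (t, h).
  by rewrite -(gg' t h tT hG); exact: Bg.
Qed.

Lemma exists_dual_power (F : circle R -> Gamma -> circle R) :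
  (forall t, zmod_morphism (F t)) -> exists f : X, forall t g, ev (t, g) f = F t g.
Proof.
by move=> FH; exists (fun t => exist (fun h => h \in _) (F t) (mem_set (FH t))).
Qed.

Lemma dual_evalB (f : X) t : zmod_morphism (fun g => ev (t, g) f).
Proof. exact: (set_mem (svalP (f t))). Qed.

(** On each coordinate [f] is corrected by a homomorphism that vanishes on a subgroup containing [G]
    and equals the missing difference on the tail. *)
Lemma prescribe_tail (f : X) (G : seq Gamma) : exists N, exists f' : X,
  (forall t g, g \in G -> ev (t, g) f = ev (t, g) f') /\
  forall n t, (N <= n)%N -> ev (t, e n) f' = y n t.
Proof.
have [S [N [sS SG fS]]] := free_mod_seq _ _ G e_free.
have /choice[F FP] : forall t, exists F : Gamma -> circle R, [/\ zmod_morphism F,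
    forall x, S x -> F x = 0 & forall n, (N <= n)%N -> F (e n) = y n t - ev (t, e n) f].
  move=> t; apply: free_mod_hom sS fS => n z n0; exact: circle_divisible.
have [|f' f'E] := exists_dual_power (fun t g => ev (t, g) f + F t g).
  move=> t g h; have [FH _ _] := FP t.
  by rewrite FH dual_evalB opprD addrACA.
exists N, f'; split => [t g gG|n t Nn]; rewrite f'E; have [_ FS FN] := FP t.
  by rewrite FS ?addr0 //; exact: SG.
by rewrite FN // addrC subrK.
Qed.

Lemma refine (V Q : set X) T G j :
  open V -> V !=set0 -> supported V T G -> open Q -> dense Q ->
  exists i V' T' G', [/\ (j <= i)%N, {subset T <= T'},
    [/\ open V', V' !=set0 & supported V' T' G'] &
    closure V' `<=` V `&` Q `&` [set f | {in T, forall t,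
      {in index_iota (a i) (b i), forall n, near_zero R j (ev (t, e n) f - y n t)}}]].
Proof.
move=> oV [f Vf] sV oQ dQ.
have [N [f1 [f1G f1y]]] := prescribe_tail f G.
(* Since [a i >= i >= N], block [i] lies in the tail where [f1] agrees with [y]. *)
pose i := maxn j N.
pose D := [set f : X | {in T, forall t, {in index_iota (a i) (b i), forall n,
  near_zero R j (ev (t, e n) f - y n t)}}].
have oD : open D.
  apply: (open_seq_forall _ _ T (fun t => [set f : X | {in index_iota (a i) (b i),
    forall n, near_zero R j (ev (t, e n) f - y n t)}])) => t _.
  apply: (open_seq_forall _ _ (index_iota (a i) (b i))
    (fun n => (fun f : X => ev (t, e n) f - y n t) @^-1` near_zero R j)) => n _.
  have : continuous (fun g : X => ev (t, e n) g - y n t).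
    exact: continuous_subr_cst (dual_eval_continuous _ _ _).
  by move/continuousP; apply; exact: open_near_zero.
have Vf1 : V f1 by apply: sV Vf => t g _ gG; exact: f1G.
have Df1 : D f1.
  move=> t _ n; rewrite mem_index_iota => /andP[an _].
  rewrite f1y ?subrr; first exact: near_zero0.
  by rewrite (leq_trans _ an) // (leq_trans _ (ia i)) // leq_maxr.
have [q [[Vq Dq] Qq]] : (V `&` D) `&` Q !=set0.
  by apply: dQ; [exists f1|exact: openI].
have [V' [T' [G' [oV' V'q clV' sV']]]] :
    exists V' T' G', [/\ open V', V' q, closure V' `<=` V `&` Q `&` D & supported V' T' G'].
  by apply: open_supported_shrink => //; apply: openI => //; exact: openI.
exists i, V', (T ++ T'), G'; split => //.
- exact: leq_maxl.
- by move=> t tT; rewrite mem_cat tT.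
- split => //; first by exists q.
  move=> g g' gg' Vg; apply: sV' (Vg) => t h tT hG.
  by apply: gg' => //; rewrite mem_cat tT orbT.
Qed.

(** [st_block] is the block used to reach the stage, so its value at the initial stage is a
    dummy. *)
Record stage := Stage { st_index : nat; st_block : nat; st_open : set X;
  st_coord : seq (circle R); st_elts : seq Gamma }.

Lemma generic_point (W : set X) (Q : nat -> set X) : open W -> W !=set0 ->
    (forall n, open (Q n) /\ dense (Q n)) ->
  exists (h : X) (i : nat -> nat), [/\ W h, forall n, Q n h, forall j, (j <= i j)%N &
    forall t, \forall j \near \oo, {in index_iota (a (i j)) (b (i j)), forall n,
      near_zero R j (ev (t, e n) h - y n t)}].
Proof.
move=> oW [w Ww] oQ.
pose good s := [/\ open (st_open s), st_open s !=set0 &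
  supported (st_open s) (st_coord s) (st_elts s)].
pose next s s' := [/\ st_index s' = (st_index s).+1, (st_index s <= st_block s')%N,
  {subset st_coord s <= st_coord s'} & closure (st_open s') `<=`
    st_open s `&` Q (st_index s) `&` [set f | {in st_coord s, forall t,
      {in index_iota (a (st_block s')) (b (st_block s')), forall n,
        near_zero R (st_index s) (ev (t, e n) f - y n t)}}]].
have [V0 [T0 [G0 [oV0 V0w clV0 sV0]]]] := open_supported_shrink W w oW Ww.
have good0 : good (Stage 0 0 V0 T0 G0) by split => //; exists w.
have step (s : {s | good s}) : {s' : {s | good s} | next (sval s) (sval s')}.
  apply: cid; case: s => -[j i V T G] gs; have [/= oV Vn sV] := gs.
  have [i' [V' [T' [G' [ji TT' gs' clV']]]]] :=
    refine V (Q j) T G j oV Vn sV (oQ j).1 (oQ j).2.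
  have gs2 : good (Stage j.+1 i' V' T' G') by [].
  by exists (exist _ _ gs2); split.
have [s [s0 sS]] := dependent_choice step (exist _ _ good0).
pose V j := st_open (sval (s j)); pose T j := st_coord (sval (s j)).
pose i j := st_block (sval (s j.+1)).
have idx j : st_index (sval (s j)) = j.
  by elim: j => [|j IH]; [rewrite s0|have [-> _ _ _] := sS j; rewrite IH].
have goodV j : good (sval (s j)) := svalP (s j).
have sSV j : closure (V j.+1) `<=` V j `&` Q j `&` [set f | {in T j, forall t,
      {in index_iota (a (i j)) (b (i j)), forall n,
        near_zero R j (ev (t, e n) f - y n t)}}].
  by have [_ _ _] := sS j; rewrite idx.
have TS j : {subset T j <= T j.+1} by have [_ _] := sS j.
have Tle j k : (j <= k)%N -> {subset T j <= T k}.
  move/subnKC <-; elim: (k - j)%N => [|d IH t tT]; first by rewrite addn0.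
  by rewrite addnS; apply/TS/IH.
have [||h0 h0P] := nested_closure_meet X V (dual_power_compact R Gamma).
- by move=> j; have [] := goodV j.
- by move=> j f Vf; have [[]] := sSV j f (subset_closure Vf).
have Vh0 j : V j h0 by have [[]] := sSV j h0 (h0P j.+1).
have /choice[F FP] : forall t, exists F : Gamma -> circle R, zmod_morphism F /\
    forall n, F (e n) = y n t.
  move=> t; have [|||F [FH _ FE]] := free_mod_hom Gamma e (circle R) [set 0] 0 (y ^~ t).
  - by move=> n z; exact: circle_divisible.
  - by split=> // x z -> ->; rewrite /= subrr.
  - exact: e_free.
  - by exists F; split => // n; exact: FE.
pose C t := `[< exists j, t \in T j >].
have [|h hE] := exists_dual_power (fun t g => if C t then ev (t, g) h0 else F t g).
  by move=> t g g'; case: (C t); [exact: dual_evalB|have [-> _] := FP t].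
(* Passing from [h0] to [h] alters no coordinate in any [T j], and [V j] depends on those in [T j]
   alone. *)
have Vh j : V j h.
  have [_ _ sV] := goodV j; apply: sV (Vh0 j) => t g tT _.
  by rewrite hE ifT //; apply/asboolP; exists j.
have hP j := sSV j h (subset_closure (Vh j.+1)).
exists h, i; split.
- by apply/clV0/subset_closure; have := Vh 0%N; rewrite /V s0.
- by move=> j; have [[]] := hP j.
- by move=> j; have [_ + _ _] := sS j; rewrite idx.
(* A constrained coordinate stays constrained at all later stages; on any other, [h] equals [y]
   along [e]. *)
move=> t; have [[j tj]|nC] := pselect (exists j, t \in T j).
  by exists j => // k /= jk; have [_] := hP k; apply; exact: Tle tj.
apply: nearW => k n _; rewrite hE ifF; last exact/asboolPn.
by rewrite (FP t).2 subrr; exact: near_zero0.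
Qed.

End Construction.

(** * Density and the Baire property *)

Theorem theorem5p1 (R : realType) (Gamma : zmodType) (E : set Gamma)
    (e : nat -> Gamma) (e_enum : set_bij [set: nat] E e)
    (E_indep : independent E)
    (E_inf : forall g : Gamma, E g -> infinite_order g) :
  let U : set {ptws circle R -> discrete_dual R Gamma} :=
    [set h | ud_homs R e (tilde h)] in
  dense U /\ baire_property U.
Proof.
move=> U.
(* The Baire property comes first: with every [Q n] the whole space it yields density. *)
have baire : baire_property U.
  move=> W Q oW W0 oQ.
  have e_free := independent_free Gamma e E e_enum E_indep E_inf.
  have [Y [Y0 chiY]] := finite_approximation R.
  have [y [a [b [ab yY]]]] := block_concatenation _ (0 : {ptws circle R -> circle R}) Y Y0.
  have ia i : (i <= a i)%N by have [] := ab i.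
  have [h [i [Wh Qh ji hy]]] := generic_point R Gamma e e_free y a b ia W Q oW W0 oQ.
  exists h; split; last by split => // n _; exact: Qh.
  split; first exact: tilde_Hom.
  apply: (weakly_ud_of_blocks R {ptws circle R -> circle R} _ y i a b) => //.
  - by move=> k; have [] := ab k.
  - move=> chi chich chi1; apply: filterS (chiY chi chich chi1) => k.
    exact: (yY _ (fun f => circle_val (chi f))).
  move=> V nV.
  (* A neighbourhood of [0] in the power restricts finitely many coordinates, so closeness on each
     single coordinate is enough. *)
  have [F [B [oB BV]]] := initial_family_support (ptws_initial _ _) nV.
  have : \forall j \near \oo, {in F, forall t, forall n, (a (i j) <= n < b (i j))%N ->
      B t (tilde h (e n) t - y n t)}.
    apply: near_seq => t _.
    have nB : nbhs (0 : circle R) (B t) by exact: open_nbhs_nbhs (oB t).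
    near=> j => n nab.
    apply: (near (near_zero_basis R _ nB) j) => //.
    by apply: (near (hy t) j) => //; rewrite mem_index_iota.
  apply: filterS => j jF n nab; apply: BV => t tF.
  exact: jF.
split=> // W W0 oW.
have [||h [Uh [Wh _]]] := baire W (fun=> setT) oW.
- exact: W0.
- by move=> _; split; [exact: openT|move=> A A0 _; rewrite setIT].
by exists h.
Unshelve. all: by end_near. Qed.
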